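(* Let $F$ be a finite ordered forest (a finite sequence of rooted planar trees). The number of closed flows on $F$ equals the number of binary trees $T'$ with $T'\le T(F)$ in the Tamari order.
   Context: A flow on $F$ assigns to each node an integer input $i\ge -1$ such that the outgoing rate of every node is $\ge 0$, where the outgoing rate of a node is its input plus the sum of the outgoing rates of its children. The exit rate is the sum of the outgoing rates of the roots; the flow is closed if the exit rate is $0$. Binary trees: either empty (a leaf) or a root with an ordered pair (left, right) of binary trees; the size is the number of internal nodes. The binary tree $T(F)$ is defined recursively: $T(\emptyset)$ is the empty tree; if $F=(t_1,\dots,t_k)$ with $k\ge1$ and the last tree $t_k$ has root $\rho$ with ordered forest of subtrees $G$ (the subtrees of the children of $\rho$, left to right), then $T(F)$ is the binary tree with a root whose left subtree is $T((t_1,\dots,t_{k-1}))$ and right subtree is $T(G)$. The right rotation replaces a subtree $y(x(A,B),C)$ by $x(A,y(B,C))$ (where $z(L,R)$ denotes root $z$ with left subtree $L$ and right subtree $R$). The Tamari order on binary trees of a given size is defined by $T\le T'$ iff $T'$ is obtained from $T$ by a finite (possibly empty) sequence of right rotations. *)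

(* Defs.v *)
From Stdlib Require Import Relations.
From mathcomp Require Import all_boot all_order all_algebra.

Set Implicit Arguments.
Unset Strict Implicit.
Unset Printing Implicit Defensive.

Import Order.TTheory GRing.Theory Num.Theory.
Local Open Scope ring_scope.

Inductive tree : Type := Node of seq tree.

Definition forest : Type := seq tree.

(* An assignment of an integer to every node of a planar tree is stored as a  *)
(* planar tree carrying one integer per node; [skeleton] forgets the integers.*)
(* Assignments on [F] are thus the decorated forests whose skeleton is [F].   *)
Inductive dtree : Type := DNode of int & seq dtree.

Fixpoint skeleton (t : dtree) : tree :=
  let: DNode _ ts := t in Node (map skeleton ts).

(* [foldr +%R 0] is used instead of [\sum_] inside the recursion because the  *)
(* locked [bigop] is not accepted by the guard condition (see [outrateE]).    *)
Fixpoint outrate (t : dtree) : int :=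
  let: DNode i ts := t in i + foldr +%R 0 (map outrate ts).

Lemma outrateE (i : int) (ts : seq dtree) :
  outrate (DNode i ts) = i + \sum_(t <- ts) outrate t.
Proof. by rewrite /= foldrE big_map. Qed.

Fixpoint valid_rates (t : dtree) : bool :=
  let: DNode i ts := t in [&& -1 <= i, 0 <= outrate t & all valid_rates ts].

Definition is_flow (F : forest) (f : seq dtree) : Prop :=
  map skeleton f = F /\ all valid_rates f.

Definition exit_rate (f : seq dtree) : int := \sum_(t <- f) outrate t.

Definition is_closed_flow (F : forest) (f : seq dtree) : Prop :=
  is_flow F f /\ exit_rate f = 0.

Inductive bintree : Type :=
  | BLeaf
  | BNode of bintree & bintree.

Fixpoint bsize (T : bintree) : nat :=
  if T is BNode L R then (bsize L + bsize R).+1 else 0%N.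

(* [bintree_of_tree (Node G)] is T(G), and [foldl] adds the trees of a forest *)
(* from left to right, so that the last one ends up at the root: the defining *)
(* equations are [bintree_of_nil] and [bintree_of_rcons].                     *)
Fixpoint bintree_of_tree (t : tree) : bintree :=
  let: Node G := t in
  foldl (fun T u => BNode T (bintree_of_tree u)) BLeaf G.

Definition bintree_of (F : forest) : bintree :=
  foldl (fun T t => BNode T (bintree_of_tree t)) BLeaf F.

Lemma bintree_of_nil : bintree_of [::] = BLeaf.
Proof. by []. Qed.

Lemma bintree_of_rcons (F G : forest) :
  bintree_of (rcons F (Node G)) = BNode (bintree_of F) (bintree_of G).
Proof. by rewrite /bintree_of foldl_rcons. Qed.

Inductive right_rotation : bintree -> bintree -> Prop :=
  | RotRoot A B C :
      right_rotation (BNode (BNode A B) C) (BNode A (BNode B C))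
  | RotLeft L L' R :
      right_rotation L L' -> right_rotation (BNode L R) (BNode L' R)
  | RotRight L R R' :
      right_rotation R R' -> right_rotation (BNode L R) (BNode L R').

(* Comparable trees automatically have the same size (see [tamari_size]), so  *)
(* this is the disjoint union of the Tamari orders over all sizes.            *)
Definition tamari : bintree -> bintree -> Prop :=
  clos_refl_trans bintree right_rotation.

Lemma tamari_size (T T' : bintree) : tamari T T' -> bsize T = bsize T'.
Proof.
elim=> [{}T {}T' | // | T1 T2 T3 _ -> _ -> //].
elim=> [A B C | L L' R _ /= -> // | L R R' _ /= -> //] /=.
by rewrite addSn addnS addnA.
Qed.

(* Main.v *)
(* Let the spine of a binary tree [Z] be the length of its left branch, i.e.  *)
(* the number [m] of trees of the corresponding forest. For every [k], the    *)
(* flows on [F] with exit rate [k] are equinumerous with the pairs of a       *)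
(* [Z <= T(F)] and a sequence of [m] natural numbers with sum [k]; closed     *)
(* flows are the case [k = 0]. Both sides obey the same recursion along       *)
(* [T(F) = BNode L R]. Flows: if the last root has outgoing rate [j], the     *)
(* flow above it has any exit rate [l <= j + 1]. Tamari order: [Z] is below   *)
(* [BNode L R] iff it arises from unique [L' <= L] and [R' <= R] by inserting *)
(* [BNode L' _] at one of the [spine R' + 1] places of the left branch of     *)
(* [R'], which gives [Z] the spines [spine L' + 1], ...,                      *)
(* [spine L' + spine R' + 1].                                                 *)

Require Import Defs.
From HB Require Import structures.
From Stdlib Require Import Relations.
From mathcomp Require Import all_boot.
From mathcomp Require Import all_algebra zify finmap.
From mathcomp Require Import boolp classical_sets functions cardinality.

Set Implicit Arguments.
Unset Strict Implicit.
Unset Printing Implicit Defensive.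

Local Open Scope classical_set_scope.
Local Open Scope card_scope.

(** Both sides are listed without repetition by recursion on the binary tree: [flows] ([mem_flows],
    [uniq_flows]) and [lower] ([mem_lower], [uniq_lower]). The recursive description of Tamari
    down-sets is [tamari_BNodeP]. The counts are matched for all exit rates [k] at once in
    [size_flows], whose inductive step is the binomial identity [weak_comp_convolution]. At [k = 0]
    every weight [weak_comp 0 m] is 1. *)

HB.instance Definition _ := gen_eqMixin dtree.
HB.instance Definition _ := gen_choiceMixin dtree.
HB.instance Definition _ := gen_eqMixin bintree.
HB.instance Definition _ := gen_choiceMixin bintree.

Lemma card_eq_size (T : choiceType) (A : set T) (s : seq T) :
  uniq s -> (forall x, A x <-> x \in s) -> A #= `I_(size s).
Proof.
move=> s_uniq AE.
have -> : A = [set` [fset x in s]%fset].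
  by apply/seteqP; split=> x /=; rewrite !inE => /AE.
by apply/card_eq_fsetP; rewrite card_fseq undup_id.
Qed.

Lemma size_flatten_map (S T : Type) (g : S -> seq T) (s : seq S) :
  size (flatten [seq g x | x <- s]) = \sum_(x <- s) size (g x).
Proof. by rewrite size_flatten /shape -map_comp sumnE big_map. Qed.

Lemma uniq_flatten_map (S T : eqType) (g : S -> seq T) (s : seq S) :
  uniq s -> {in s, forall x, uniq (g x)} ->
  {in s &, forall x y z, z \in g x -> z \in g y -> x = y} ->
  uniq (flatten [seq g x | x <- s]).
Proof.
elim: s => //= x s IHs /andP[s'x s_uniq] g_uniq g_disj.
rewrite cat_uniq g_uniq ?mem_head //= IHs //; first last.
- by move=> y z ys zs; apply: g_disj; rewrite inE ?ys ?zs orbT.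
- by move=> y ys; apply: g_uniq; rewrite inE ys orbT.
rewrite andbT; apply/hasPn => z /flatten_mapP[y ys zy]; apply/negP => /= zx.
by move: s'x; rewrite (g_disj x y _ _ z) ?ys // ?mem_head // inE ys orbT.
Qed.

(** * Weak compositions *)

(* The number of sequences of [m] natural numbers with sum [k]; truncation    *)
(* makes it [k == 0] when [m = 0].                                            *)
Definition weak_comp (k m : nat) : nat := 'C((m + k).-1, k).

Lemma weak_comp0 m : weak_comp 0 m = 1.
Proof. by rewrite /weak_comp bin0. Qed.

Lemma weak_compS0 k : weak_comp k.+1 0 = 0.
Proof. by rewrite /weak_comp add0n bin_small. Qed.

Lemma weak_comp1 k : weak_comp k 1 = 1.
Proof. by rewrite /weak_comp add1n binn. Qed.

Lemma weak_compSS k m :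
  weak_comp k.+1 m.+1 = weak_comp k.+1 m + weak_comp k m.+1.
Proof. by rewrite /weak_comp !addSn addnS /= binS. Qed.

(** The extra entry is the slack [k - l]. *)
Lemma sum_weak_comp k m : \sum_(l < k.+1) weak_comp l m = weak_comp k m.+1.
Proof.
elim: k => [|k IHk]; first by rewrite big_ord1 !weak_comp0.
by rewrite big_ord_recr IHk /= weak_compSS addnC.
Qed.

(** Cut a sequence after its first [a] entries; [j] is the sum of the remaining [b]. *)
Lemma weak_comp_vandermonde k a b :
  \sum_(j < k.+1) weak_comp (k - j) a * weak_comp j b = weak_comp k (a + b).
Proof.
elim: b k => [|b IHb] k.
  rewrite big_ord_recl subn0 weak_comp0 muln1 addn0 big1 ?addn0 // => j _.
  by rewrite /= weak_compS0 muln0.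
elim: k => [|k IHk]; first by rewrite big_ord1 !weak_comp0.
rewrite big_ord_recl weak_comp0 addnS weak_compSS -IHb -addnS -IHk.
rewrite [in RHS]big_ord_recl weak_comp0 -addnA; congr addn.
by rewrite -big_split /=; apply: eq_bigr => j _; rewrite weak_compSS mulnDr.
Qed.

(** By Pascal's rule, raising [b] by one adds a Vandermonde sum, which is the new last term on the
    right. *)
Lemma weak_comp_convolution k a b :
  \sum_(j < k.+1) weak_comp (k - j) a * weak_comp j.+1 b.+1 =
  \sum_(p < b.+1) weak_comp k (a + p).+1.
Proof.
elim: b => [|b IHb].
  rewrite big_ord1 addn0 -[a.+1]addn1 -weak_comp_vandermonde.
  by apply: eq_bigr => j _; rewrite !weak_comp1.
rewrite [RHS]big_ord_recr /= -IHb -addnS -weak_comp_vandermonde -big_split /=.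
by apply: eq_bigr => j _; rewrite weak_compSS mulnDr.
Qed.

(** * Insertions along the left branch *)

Fixpoint spine (T : bintree) : nat := if T is BNode L _ then (spine L).+1 else 0.

(* In terms of forests, [T] is split into its first and last trees, the first *)
(* ones becoming the children of a new root, itself preceded by the forest    *)
(* [L]; all splittings are listed.                                            *)
Fixpoint insertions (L T : bintree) : seq bintree :=
  BNode L T ::
  (if T is BNode A B then [seq BNode Z B | Z <- insertions L A] else [::]).

Fixpoint lower (T : bintree) : seq bintree :=
  if T is BNode L R then
    flatten [seq flatten [seq insertions L' R' | R' <- lower R] | L' <- lower L]
  else [:: BLeaf].

Lemma sum_spine_insertions (F : nat -> nat) (L T : bintree) :
  \sum_(Z <- insertions L T) F (spine Z) =
  \sum_(p < (spine T).+1) F (spine L + p).+1.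
Proof.
elim: T F => [|A IHA B _] F /=; rewrite big_cons.
  by rewrite big_nil big_ord1 !addn0.
rewrite big_map [RHS]big_ord_recl addn0 (IHA (fun n => F n.+1)) /=.
by congr addn; apply: eq_bigr => p _; rewrite addnS.
Qed.

Lemma bsize_insertions (L T Z : bintree) :
  Z \in insertions L T -> bsize Z = (bsize L + bsize T).+1.
Proof.
elim: T Z => [|A IHA B _] Z /=; rewrite inE.
  by move=> /eqP->.
case/orP=> [/eqP-> //|/mapP[Y /IHA sizeY ->] /=].
by rewrite sizeY addnS addSn addnA.
Qed.

(** Left subtrees shrink strictly down the left branch of [Z], so the size of the inserted tree
    fixes the place of insertion. *)
Lemma insertions_inj {L1 L2 T1 T2 Z : bintree} :
  bsize L1 = bsize L2 -> Z \in insertions L1 T1 -> Z \in insertions L2 T2 ->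
  L1 = L2 /\ T1 = T2.
Proof.
move=> sizeL; elim: T1 T2 Z => [|A1 IHA B1 _] T2 Z /=; rewrite inE.
  move=> /eqP->; case: T2 => [|A2 B2] /=; rewrite inE.
    by move=> /eqP[->].
  case/orP=> [/eqP[-> //]|/mapP[Y /bsize_insertions sizeY [L1Y _]]].
  by move: sizeY; rewrite -L1Y sizeL; lia.
case/orP=> [/eqP->|/mapP[Y1 Y1in ->]]; case: T2 => [|A2 B2] /=; rewrite inE.
- by move=> /eqP[-> <-].
- case/orP=> [/eqP[-> -> -> //]|/mapP[Y /bsize_insertions sizeY [L1Y _]]].
  by move: sizeY; rewrite -L1Y sizeL; lia.
- move=> /eqP[Y1L _].
  by move/bsize_insertions: Y1in; rewrite Y1L sizeL; lia.
- case/orP=> [/eqP[Y1L _]|/mapP[Y2 Y2in [Y12 <-]]].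
    by move/bsize_insertions: Y1in; rewrite Y1L sizeL; lia.
  by rewrite -Y12 in Y2in; have [-> ->] := IHA _ _ Y1in Y2in.
Qed.

Lemma uniq_insertions (L T : bintree) : uniq (insertions L T).
Proof.
elim: T => [|A IHA B _] //=; rewrite map_inj_uniq ?IHA ?andbT; last by move=> ? ? [].
by apply/negP => /mapP[Y /bsize_insertions sizeY [LY _]]; move: sizeY; rewrite -LY; lia.
Qed.

(** * Down-sets of the Tamari order *)

Lemma tamari_refl (T : bintree) : tamari T T.
Proof. exact: rt_refl. Qed.

Lemma tamari_trans {T1 T2 T3 : bintree} :
  tamari T1 T2 -> tamari T2 T3 -> tamari T1 T3.
Proof. exact: rt_trans. Qed.

Lemma tamari_rot {T T' : bintree} : right_rotation T T' -> tamari T T'.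
Proof. exact: rt_step. Qed.

Lemma tamari_BNode (L L' R R' : bintree) :
  tamari L L' -> tamari R R' -> tamari (BNode L R) (BNode L' R').
Proof.
move=> LL RR; apply: (@tamari_trans _ (BNode L' R)).
  elim: LL => [U V /(RotLeft R)|U|U V W _ UV _ VW]; first exact: tamari_rot.
    exact: tamari_refl.
  exact: tamari_trans UV VW.
elim: RR => [U V /(RotRight L')|U|U V W _ UV _ VW]; first exact: tamari_rot.
  exact: tamari_refl.
exact: tamari_trans UV VW.
Qed.

Lemma tamari_insertions (L T Z : bintree) :
  Z \in insertions L T -> tamari Z (BNode L T).
Proof.
elim: T Z => [|A IHA B _] Z /=; rewrite inE.
  by move=> /eqP->; apply: tamari_refl.
case/orP=> [/eqP->|/mapP[Y /IHA leY ->]]; first exact: tamari_refl.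
apply: tamari_trans (tamari_rot (RotRoot L A B)).
exact: tamari_BNode leY (tamari_refl _).
Qed.

Lemma insertions_head (L T : bintree) : BNode L T \in insertions L T.
Proof. by case: T => [|A B]; rewrite mem_head. Qed.

Lemma insertions_left (L A B Z : bintree) :
  Z \in insertions L A -> BNode Z B \in insertions L (BNode A B).
Proof. by move=> Zin; rewrite inE map_f ?orbT. Qed.

Lemma right_rotation_BNodeP (Z L T : bintree) :
  right_rotation Z (BNode L T) ->
  [\/ exists B C, T = BNode B C /\ Z = BNode (BNode L B) C,
      exists2 L0, right_rotation L0 L & Z = BNode L0 T
    | exists2 T0, right_rotation T0 T & Z = BNode L T0].
Proof.
move Z'E: (BNode L T) => Z' rot; move: Z'E.
case: rot => [A B C|L0 L1 R rot|L1 R0 R rot] [-> ->].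
- by constructor 1; exists B, C.
- by constructor 2; exists L0.
- by constructor 3; exists R0.
Qed.

Lemma BNode_unrotate (L T Z : bintree) :
  right_rotation Z (BNode L T) ->
  exists L0 T0, [/\ tamari L0 L, tamari T0 T & Z \in insertions L0 T0].
Proof.
case/right_rotation_BNodeP=> [[B [C [-> ->]]]|[L0 rot ->]|[T0 rot ->]].
- exists L, (BNode B C); split; try exact: tamari_refl.
  exact/insertions_left/insertions_head.
- exists L0, T; split; [exact: tamari_rot|exact: tamari_refl|exact: insertions_head].
- exists L, T0; split; [exact: tamari_refl|exact: tamari_rot|exact: insertions_head].
Qed.

(** Undoing a rotation at the inserted node moves the insertion one place down the left branch and
    keeps [L] and [T]; anywhere else it undoes a rotation of [L] or of [T]. *)
Lemma insertions_unrotate (L T Z Z0 : bintree) :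
  Z \in insertions L T -> right_rotation Z0 Z ->
  exists L0 T0, [/\ tamari L0 L, tamari T0 T & Z0 \in insertions L0 T0].
Proof.
elim: T Z Z0 => [|A IHA B _] Z Z0 /=; rewrite inE.
  by move=> /eqP->; apply: BNode_unrotate.
case/orP=> [/eqP->|/mapP[Y Yin ->]]; first exact: BNode_unrotate.
case/right_rotation_BNodeP=> [[C [D [-> ->]]]|[Y0 rot ->]|[B0 rot ->]].
- exists L, (BNode (BNode A C) D); split; first exact: tamari_refl.
    exact/tamari_rot/RotRoot.
  exact/insertions_left/insertions_left.
- have [L1 [A1 [leL leA inA]]] := IHA _ _ Yin rot.
  exists L1, (BNode A1 B); split=> //; last exact: insertions_left.
  exact: tamari_BNode leA (tamari_refl _).
- exists L, (BNode A B0); split; first exact: tamari_refl.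
    exact: tamari_BNode (tamari_refl _) (tamari_rot rot).
  exact: insertions_left.
Qed.

Lemma tamari_BNodeP (L R Z : bintree) :
  tamari Z (BNode L R) <->
  exists L' R', [/\ tamari L' L, tamari R' R & Z \in insertions L' R'].
Proof.
split=> [|[L' [R' [leL leR /tamari_insertions leZ]]]]; last first.
  exact: (tamari_trans leZ (tamari_BNode leL leR)).
(* Chains are peeled from their lowest rotation, so the induction hypothesis already describes
   [Y]. *)
move/(@clos_rt_rt1n _ _ _ _); move ZE: (BNode L R) => T leZ.
elim: leZ ZE => {Z T} [Z <-|Z Y T rot _ IH /IH[L' [R' [leL leR Yin]]]].
  by exists L, R; split; [exact: tamari_refl|exact: tamari_refl|exact: insertions_head].
have [L0 [R0 [leL0 leR0 Zin]]] := insertions_unrotate Yin rot.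
by exists L0, R0; split=> //; [apply: tamari_trans leL|apply: tamari_trans leR].
Qed.

Lemma tamari_BLeafP (Z : bintree) : tamari Z BLeaf <-> Z = BLeaf.
Proof.
split=> [/tamari_size|->]; last exact: tamari_refl.
by case: Z.
Qed.

Lemma mem_lower (Z T : bintree) : tamari Z T <-> Z \in lower T.
Proof.
elim: T Z => [|L IHL R IHR] Z /=.
  by rewrite inE; split=> [/tamari_BLeafP->|/eqP/tamari_BLeafP].
split=> [/tamari_BNodeP[L' [R' [/IHL inL /IHR inR Zin]]]|].
  by apply/flatten_mapP; exists L' => //; apply/flatten_mapP; exists R'.
case/flatten_mapP=> L' /IHL leL /flatten_mapP[R' /IHR leR Zin].
by apply/tamari_BNodeP; exists L', R'.
Qed.

Lemma uniq_lower (T : bintree) : uniq (lower T).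
Proof.
have sizeL L L1 L2 : L1 \in lower L -> L2 \in lower L -> bsize L1 = bsize L2.
  by move=> /mem_lower/tamari_size-> /mem_lower/tamari_size->.
elim: T => [|L IHL R IHR] //=; apply: uniq_flatten_map => //.
  move=> L' _; apply: uniq_flatten_map => // [R' _|R1 R2 _ _ Z].
    exact: uniq_insertions.
  by move=> /(insertions_inj erefl) inj /inj[].
move=> L1 L2 /sizeL eqL /eqL{}eqL Z /flatten_mapP[R1 _ Z1] /flatten_mapP[R2 _ Z2].
by have [] := insertions_inj eqL Z1 Z2.
Qed.

(** * Enumeration of flows *)

(* The outgoing rate of the root is [j] and that of the forest above it [l],  *)
(* so that the input of the root is [j - l].                                  *)
Definition root_flows (flowsG : nat -> seq (seq dtree)) (j : nat) : seq dtree :=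
  flatten [seq [seq DNode (j%:Z - l%:Z)%R g | g <- flowsG l] | l <- iota 0 j.+2].

Fixpoint flows (T : bintree) (k : nat) : seq (seq dtree) :=
  if T is BNode L R then
    flatten [seq [seq rcons f t | f <- flows L (k - j), t <- root_flows (flows R) j]
            | j <- iota 0 k.+1]
  else if k == 0 then [:: [::]] else [::].

Lemma flows_BNode (L R : bintree) (k : nat) :
  flows (BNode L R) k =
  flatten [seq [seq rcons f t | f <- flows L (k - j), t <- root_flows (flows R) j]
          | j <- iota 0 k.+1].
Proof. by []. Qed.

Lemma size_root_flows (flowsG : nat -> seq (seq dtree)) (j : nat) :
  size (root_flows flowsG j) = \sum_(l < j.+2) size (flowsG l).
Proof.
rewrite size_flatten_map -/(index_iota 0 j.+2) big_mkord.
by apply: eq_bigr => l _; rewrite size_map.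
Qed.

Lemma size_flows (T : bintree) (k : nat) :
  size (flows T k) = \sum_(Z <- lower T) weak_comp k (spine Z).
Proof.
elim: T k => [|L IHL R IHR] k.
  by rewrite big_seq1; case: k => [|k]; rewrite ?weak_comp0 ?weak_compS0.
rewrite flows_BNode size_flatten_map -/(index_iota 0 k.+1) big_mkord.
(* Summing over the exit rate [l <= j + 1] above the last root turns [weak_comp l (spine R')] into
   [weak_comp j.+1 (spine R').+1]. *)
transitivity (\sum_(j < k.+1) \sum_(L' <- lower L) \sum_(R' <- lower R)
    weak_comp (k - j) (spine L') * weak_comp j.+1 (spine R').+1).
  apply: eq_bigr => j _; rewrite size_allpairs size_root_flows IHL big_distrl.
  apply: eq_bigr => L' _ /=; rewrite -big_distrr; congr muln.
  under eq_bigr do rewrite IHR.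
  by rewrite exchange_big; apply: eq_bigr => R' _; apply: sum_weak_comp.
rewrite exchange_big big_flatten big_map; apply: eq_bigr => L' _ /=.
rewrite exchange_big big_flatten big_map; apply: eq_bigr => R' _ /=.
by rewrite weak_comp_convolution sum_spine_insertions.
Qed.

Lemma exit_rate_rcons (f : seq dtree) (t : dtree) :
  exit_rate (rcons f t) = (exit_rate f + outrate t)%R.
Proof. by rewrite /exit_rate big_rcons. Qed.

Lemma outrate_DNode (i : int) (g : seq dtree) :
  outrate (DNode i g) = (i + exit_rate g)%R.
Proof. exact: outrateE. Qed.

Lemma outrate_ge0 (t : dtree) : valid_rates t -> (0 <= outrate t)%R.
Proof. by case: t => i g /and3P[]. Qed.

Lemma exit_rate_ge0 (f : seq dtree) :
  all valid_rates f -> (0 <= exit_rate f)%R.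
Proof.
elim: f => [|t f IHf]; first by rewrite /exit_rate big_nil.
case/andP=> /outrate_ge0 t_ge0 /IHf f_ge0.
by rewrite /exit_rate big_cons -/(exit_rate f); lia.
Qed.

Lemma mem_root_flows (flowsG : nat -> seq (seq dtree)) (G : forest) (j : nat)
    (t : dtree) :
  (forall l g, g \in flowsG l <-> is_flow G g /\ exit_rate g = l) ->
  t \in root_flows flowsG j <->
  [/\ skeleton t = Node G, valid_rates t & outrate t = j].
Proof.
move=> flowsGP; split=> [/flatten_mapP[l]|].
  rewrite mem_iota => lj /mapP[g /flowsGP[[<- g_valid] g_exit] ->].
  rewrite outrate_DNode g_exit; split=> //; last lia.
  apply/and3P; split=> //; first lia.
  by rewrite outrate_DNode g_exit; lia.
case: t => i g [[gG] /and3P[i_ge _ g_valid]].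
rewrite outrate_DNode => rate_j.
have g_ge0 := exit_rate_ge0 g_valid.
have gE : exit_rate g = Posz `|exit_rate g|%N by lia.
(* The range [l < j.+2] is exactly the input condition [-1 <= i]. *)
apply/flatten_mapP; exists `|exit_rate g|%N; first by rewrite mem_iota; lia.
apply/mapP; exists g; first exact/flowsGP.
by congr DNode; lia.
Qed.

Lemma mem_flows (F : forest) (k : nat) (f : seq dtree) :
  f \in flows (bintree_of F) k <-> is_flow F f /\ exit_rate f = k.
Proof.
move TE: (bintree_of F) => T; elim: T F TE k f => [|L IHL R IHR] F.
  case/lastP: F => [_ k f|F [G]]; last by rewrite bintree_of_rcons.
  split=> [|[[/(congr1 size)]]].
    by case: k => [|k] //; rewrite inE => /eqP->; rewrite /exit_rate big_nil.
  by case: f => // _ _; rewrite /exit_rate big_nil; case: k.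
case/lastP: F => [//|F [G]]; rewrite bintree_of_rcons => -[LE RE] k f.
have rootP j t := mem_root_flows j t (IHR _ RE).
split=> [/flatten_mapP[j]|].
  rewrite mem_iota => jk /allpairsP[[f' t] /= [/(IHL _ LE)[[f'F f'_valid] f'_exit]]].
  move=> /rootP[tG t_valid t_rate ->]; split.
    by split; rewrite ?map_rcons ?f'F ?tG ?all_rcons ?t_valid.
  by rewrite exit_rate_rcons f'_exit t_rate; lia.
case/lastP: f => [|f t] [[]]; first by case: (F) => [|? ?].
rewrite map_rcons all_rcons exit_rate_rcons => /rcons_inj[fF tG].
case/andP=> t_valid f_valid exit_k.
have t_ge0 := outrate_ge0 t_valid; have f_ge0 := exit_rate_ge0 f_valid.
apply/flatten_mapP; exists `|outrate t|%N; first by rewrite mem_iota; lia.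
apply/allpairsP; exists (f, t); split=> //=.
  by apply/(IHL _ LE); split=> //; lia.
by apply/rootP; split=> //; lia.
Qed.

(** A flow determines its indices: [j] is the outgoing rate of the last root, [l] the exit rate of
    the forest above it. *)
Lemma uniq_flows (F : forest) (k : nat) : uniq (flows (bintree_of F) k).
Proof.
move TE: (bintree_of F) => T; elim: T F TE k => [|L IHL R IHR] F.
  by move=> _ [].
case/lastP: F => [//|F [G]]; rewrite bintree_of_rcons => -[LE RE] k.
have memR l g : g \in flows R l <-> is_flow G g /\ exit_rate g = l.
  by rewrite -RE; apply: mem_flows.
apply: uniq_flatten_map => [|j _|j1 j2 _ _ f]; first exact: iota_uniq.
  apply: allpairs_uniq; first exact: IHL LE _.
    apply: uniq_flatten_map => [|l _|l1 l2 _ _ t]; first exact: iota_uniq.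
      by rewrite map_inj_uniq; [exact: IHR RE _|move=> ? ? []].
    case/mapP=> g1 /memR[_ g1E] -> /mapP[g2 /memR[_ g2E] [_ g12]].
    by move: g1E; rewrite g12 g2E; lia.
  by move=> [f1 t1] [f2 t2] _ _ /= /rcons_inj[-> ->].
case/allpairsP=> [[f1 t1] [_ /(mem_root_flows _ _ memR)[_ _ t1E] ->]].
case/allpairsP=> [[f2 t2] [_ /(mem_root_flows _ _ memR)[_ _ t2E]]].
by move=> /= /rcons_inj[_ t12]; move: t1E; rewrite /= t12 t2E; lia.
Qed.

Theorem mainTheorem3 (F : forest) :
  exists n : nat,
    [set f : seq dtree | is_closed_flow F f] #= `I_n /\
    [set T' : bintree | tamari T' (bintree_of F)] #= `I_n.
Proof.
exists (size (lower (bintree_of F))); split; last first.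
  by apply: card_eq_size (uniq_lower _) _ => Z; apply: mem_lower.
have <- : size (flows (bintree_of F) 0) = size (lower (bintree_of F)).
  rewrite size_flows -sum1_size; apply: eq_bigr => Z _; exact: weak_comp0.
apply: card_eq_size (uniq_flows _ _) _ => f.
exact: iff_sym (mem_flows F 0 f).
Qed.
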